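(* Let $W$ be a positive random variable satisfying $$\lim_{x \to 0^+} \frac{\log \log \left(1/\mathbb{P}(W \leq x)\right)}{\log \log (1/x)} = \gamma$$ for some real $\gamma > 1$. Let $Y$ be a fixed point of the smoothing transform associated to $W$, i.e. a positive random variable such that $$Y \stackrel{d}{=} W_0 Y_0 + W_1 Y_1,$$ where $W_0, W_1, Y_0, Y_1$ are independent, $W_0$ and $W_1$ have the same distribution as $W$, and $Y_0$ and $Y_1$ have the same distribution as $Y$. Then $$\lim_{x \to 0^+} \frac{\log \log \left(1/\mathbb{P}(Y \leq x)\right)}{\log \log (1/x)} = \gamma.$$
   Context: A random variable $X$ is called positive if $\mathbb{P}(X>0)=1$. The symbol $\stackrel{d}{=}$ denotes equality in distribution. (Limits of Mandelbrot cascades on the binary tree generated by $W$, possibly renormalized, are examples of such fixed points $Y$.) *)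

(* Defs.v *)
From HB Require Import structures.
From mathcomp Require Import all_boot all_order all_algebra.
From mathcomp Require Import all_classical all_reals all_analysis.

Set Implicit Arguments.
Unset Strict Implicit.
Unset Printing Implicit Defensive.

Import Order.TTheory GRing.Theory Num.Theory.
Import numFieldNormedType.Exports.

Local Open Scope classical_set_scope.
Local Open Scope ring_scope.

Definition positive_RV (R : realType) (d : measure_display)
    (T : measurableType d) (P : probability T R) (X : {RV P >-> R}) : Prop :=
  P [set t | 0 < X t] = 1%E.

(* The two laws are compared on Borel sets only: the pushforward is also
   defined, but meaningless, on non-measurable sets. It is stated for bare
   functions so as to apply to an arithmetic expression in random variables. *)
Definition eq_in_distribution (R : realType) (d1 d2 : measure_display)
    (T1 : measurableType d1) (T2 : measurableType d2)
    (P1 : probability T1 R) (P2 : probability T2 R)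
    (X1 : T1 -> R) (X2 : T2 -> R) : Prop :=
  forall A : set R, measurable A -> pushforward P1 X1 A = pushforward P2 X2 A.

Definition mutually_independent (R : realType) (d : measure_display)
    (T : measurableType d) (P : probability T R) (I : finType)
    (X : I -> {RV P >-> R}) : Prop :=
  forall (J : {set I}) (A : I -> set R), (forall i, measurable (A i)) ->
  P (\bigcap_(i in [set` J]) (X i @^-1` A i)) =
  (\prod_(i in J) P (X i @^-1` A i))%E.

(* W_0, W_1, Y_0, Y_1 live on some probability space, which need not be the one
   carrying W or the one carrying Y. *)
Definition smoothing_fixed_point (R : realType) (dW dY : measure_display)
    (TW : measurableType dW) (TY : measurableType dY)
    (PW : probability TW R) (PY : probability TY R)
    (W : {RV PW >-> R}) (Y : {RV PY >-> R}) : Prop :=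
  exists (d : measure_display) (T : measurableType d) (P : probability T R)
         (W0 W1 Y0 Y1 : {RV P >-> R}),
    [/\ mutually_independent (tnth [tuple W0; W1; Y0; Y1]),
        eq_in_distribution P PW W0 W /\ eq_in_distribution P PW W1 W,
        eq_in_distribution P PY Y0 Y /\ eq_in_distribution P PY Y1 Y &
        eq_in_distribution PY P Y (fun t => W0 t * Y0 t + W1 t * Y1 t)].

(* [cdf X x] is P(X <= x). When it vanishes the quotient takes the value 0
   (as 0^-1 = 0 and ln 0 = 0) instead of +oo. As x -> 0+ this does not affect
   convergence to a nonzero real: by monotonicity, if P(X <= x) = 0 for some
   x > 0 then it vanishes for all smaller x, so that the limit would be 0. *)
Definition loglog_ratio (R : realType) (d : measure_display)
    (T : measurableType d) (P : probability T R) (X : {RV P >-> R}) (x : R) : R :=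
  ln (ln (1 / fine (cdf X x))) / ln (ln (1 / x)).

(* Main.v *)
Require Import Defs.
From HB Require Import structures.
From mathcomp Require Import all_boot all_order all_algebra ring lra.
From mathcomp Require Import all_classical all_reals all_analysis.

Import Order.TTheory GRing.Theory Num.Theory.
Import numFieldNormedType.Exports.

Local Open Scope classical_set_scope.
Local Open Scope ring_scope.

(* Write F and G for the distribution functions of Y and W.  If W_i <= a and
   Y_i <= b for i = 0, 1 then Y <= 2ab, so (G(a) F(b))^2 <= F(2ab); fixing b with
   F(b) > 0 shows that the left tail of Y is not essentially lighter than that of W.
   Conversely Y <= ab forces W_i <= a or Y_i <= b for both i, so
   F(ab) <= (G(a) + F(b))^2.  With x = exp(-t) and p < gamma, taking a = exp(-(1-r)t)
   and b = exp(-rt) with 2 r^p > 1, the square lets a bound F <= exp(-c t^p)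
   propagate from rt to t, and it holds on a first interval [r t0, t0] because F
   vanishes at 0+. *)

(** * Substitution x = exp(-t), and the log-log limit as a family of tail bounds *)

Lemma near_expRN {R : realType} (Q : R -> Prop) :
  (\forall x \near 0^'+, Q x) <-> (\forall t \near +oo, Q (expR (- t))).
Proof.
split.
  move=> [e /= e0 he]; exists (- ln e); split; first exact: num_real.
  move=> t te; apply: he; rewrite /= ?expR_gt0 // sub0r normrN 
    ger0_norm ?expR_ge0 //.
  by rewrite -[e]lnK ?posrE // ltr_expR ltrNl.
move=> [M [_ hM]]; exists (expR (- M)); rewrite /= ?expR_gt0 // => x /=.
rewrite sub0r normrN => xM x0; rewrite gtr0_norm // in xM.
have := hM (- ln x); rewrite opprK lnK ?posrE //; apply.
by rewrite ltrNr -[ltRHS]expRK ltr_ln ?posrE ?expR_gt0.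
Qed.

(** Where t > 1 and 0 < f t < 1, both logarithms can be undone monotonically, so comparing the
    quotient with p amounts to comparing f t with exp(-t^p). The limit thus splits into two
    one-sided families of bounds, which the theorem treats by separate arguments. *)
Lemma loglog_tailP {R : realType} {f : R -> R} {g : R} : 0 < g ->
  (forall t, 0 <= f t) ->
  (ln (ln (1 / f t)) / ln t @[t --> +oo] --> g) <->
  (forall p, 0 < p < g -> \forall t \near +oo, f t <= expR (- (t `^ p))) /\
  (forall q, g < q -> \forall t \near +oo, expR (- (t `^ q)) <= f t).
Proof.
move=> g0 f0.
have key t p : 1 < t -> 0 < f t -> 0 < ln (1 / f t) ->
    (p <= ln (ln (1 / f t)) / ln t) = (f t <= expR (- (t `^ p))) /\
    (ln (ln (1 / f t)) / ln t <= p) = (expR (- (t `^ p)) <= f t).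
  move=> t1 ft L0.
  have tp : 0 < t `^ p by rewrite powR_gt0 // (lt_trans ltr01).
  rewrite ler_pdivlMr ?ln_gt0 // ler_pdivrMr ?ln_gt0 //.
  rewrite -ln_powR !ler_ln ?posrE //.
  have ->: ln (1 / f t) = - ln (f t) by rewrite div1r lnV.
  rewrite -{2 4}(lnK (x := f t)) ?posrE // !ler_expR.
  by rewrite lerNr lerNl.
split.
  move=> cv.
  (* A positive quotient excludes the default values: [ln] is 0 on nonpositive reals, so ln (1 / f
     t) must be positive, and this rules out f t = 0, where 1 / f t would be 0. *)
  have pos : \forall t \near +oo, 1 < t /\ 0 < ln (ln (1 / f t)) / ln t.
    near=> t; split; first by near: t; exact: nbhs_pinfty_gt.
    by near: t; exact: (cvgr_gt _ cv).
  have pos' : \forall t \near +oo, [/\ 1 < t, 0 < f t & 0 < ln (1 / f t)].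
    near=> t; have [t1 r0] : 1 < t /\ 0 < ln (ln (1 / f t)) / ln t by near: t.
    have L0 : 0 < ln (1 / f t).
      rewrite ltNge; apply/negP => L; move: r0.
      by rewrite (ln0 L) mul0r ltxx.
    split=> //; rewrite lt_neqAle f0 andbT eq_sym; apply/eqP => ft0.
    by move: L0; rewrite ft0 invr0 mulr0 ln0 // ltxx.
  split=> [p /andP[_ pg]|q gq]; near=> t;
    have [t1 ft L] : [/\ 1 < t, 0 < f t & 0 < ln (1 / f t)] by near: t.
    rewrite -(key _ _ t1 ft L).1; near: t; exact: (cvgr_ge _ cv).
  rewrite -(key _ _ t1 ft L).2; near: t; exact: (cvgr_le _ cv).
move=> [lo up]; apply/cvgrPdist_le => e e0.
(* The maximum with g / 2 keeps [p] positive, hence in the range of [lo], even when e >= g. *)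
pose p := Num.max (g - e) (g / 2).
have pg : 0 < p < g.
  rewrite lt_max gt_max; apply/andP; split; first by apply/orP; right; lra.
  by apply/andP; split; lra.
have pge : g - e <= p by rewrite le_max lexx.
near=> t.
have t1 : 1 < t by near: t; exact: nbhs_pinfty_gt.
have lo' : f t <= expR (- (t `^ p)) by near: t; exact: lo.
have up' : expR (- (t `^ (g + e))) <= f t by near: t; apply: up; lra.
have ft : 0 < f t := lt_le_trans (expR_gt0 _) up'.
have L : 0 < ln (1 / f t).
  rewrite div1r lnV ?posrE // oppr_gt0.
  rewrite ln_lt0 // ft (le_lt_trans lo') // -expR0 ltr_expR oppr_lt0 powR_gt0 //.
move: lo' up'; rewrite -(key _ _ t1 ft L).1 -(key _ _ t1 ft L).2 ler_distl => h1 h2.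
by apply/andP; split; lra.
Unshelve. all: by end_near. Qed.

(** * Stretched exponential tails: absorbing constants, and the recursive inequality *)

Lemma near_pinfty_powR_ge {R : realType} (K : R) {p : R} : 0 < p ->
  \forall t \near +oo, K <= t `^ p.
Proof.
move=> p0; near=> t.
have t0 : 0 <= t by near: t; exact: nbhs_pinfty_ge.
have Kt : `|K| `^ (p^-1) <= t by near: t; exact: nbhs_pinfty_ge.
apply: le_trans (ler_norm K) _.
rewrite -[leLHS]powRr1 // -(mulVf (lt0r_neq0 p0)) powRrM.
by apply: ge0_ler_powR => //; rewrite ?nnegrE ?powR_ge0 // ltW.
Unshelve. all: by end_near. Qed.

(** A shift of t, a constant factor and a square change the exponent only by constants, which the
    gap between q' and q absorbs. In the application [kappa] is the value of the distribution
    function of Y at a fixed point. *)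
Lemma near_sqr_powR_tail_ge {R : realType} (C kappa q q' : R) : 0 < kappa ->
  0 <= q' < q ->
  \forall t \near +oo, expR (- (t `^ q)) <= (expR (- ((t + C) `^ q')) * kappa) ^+ 2.
Proof.
move=> k0 /andP[q'0 qq']; near=> t.
have t1 : 1 <= t by near: t; exact: nbhs_pinfty_ge.
have Ct : `|C| <= t by near: t; exact: nbhs_pinfty_ge.
(* The first term comes from the square and from t + C <= 2 t, the second from kappa^2; the latter
   may be multiplied by t^q' because t^q' >= 1. *)
have big : 2 * 2 `^ q' + 2 * `|ln kappa| <= t `^ (q - q').
  by near: t; apply: near_pinfty_powR_ge; lra.
have t0 : 0 < t by lra.
have tC : (t + C) `^ q' <= 2 `^ q' * t `^ q'.
  rewrite -powRM ?(ltW t0) //; apply: ge0_ler_powR => //; rewrite ?nnegrE.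
  - by move: Ct; rewrite ler_norml; lra.
  - by lra.
  - by move: Ct; rewrite ler_norml; lra.
have tq1 : 1 <= t `^ q' by rewrite -(powRr0 t) ler_powR.
rewrite -[X in _ * X]lnK ?posrE // -expRD -expRM_natl ler_expR.
have -> : t `^ q = t `^ (q - q') * t `^ q'.
  by rewrite -powRD ?subrK //; apply/implyP => _; rewrite gt_eqF.
have := ler_wpM2r (ltW (lt_le_trans ltr01 tq1)) big.
have : `|ln kappa| <= `|ln kappa| * t `^ q' by rewrite ler_peMr.
have := ler_norm (- ln kappa); rewrite normrN.
lra.
Unshelve. all: by end_near. Qed.

(** Induction over the scales t, r t, r^2 t, ..., applying the recursion with s = (1 - r) t. The
    constant c is whatever the starting interval allows; the theorem later removes it by giving up a
    little of the exponent. *)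
Lemma near_powR_tail_le_of_rec {R : realType} {f g : R -> R} {p : R} : 0 < p ->
  (forall t, 0 <= f t) -> (forall t, 0 <= g t) ->
  {homo f : s t /~ s <= t} ->
  f t @[t --> +oo] --> 0 ->
  (forall s t, f (s + t) <= (g s + f t) ^+ 2) ->
  (\forall t \near +oo, g t <= expR (- (t `^ p))) ->
  exists2 c, 0 < c & \forall t \near +oo, f t <= expR (- (c * t `^ p)).
Proof.
move=> p0 f0 g0 fdec fcv frec gtail.
(* Any [r] with [1/2 < r^p < 1] would do: the square in the recursion turns the
   exponent [c (r t)^p] into [2 r^p c t^p], which beats [c t^p] by a margin that
   absorbs the constant [2 ln 2] once [c t^p >= K]. *)
pose r : R := (3 / 4) `^ p^-1.
have rp : r `^ p = 3 / 4 by rewrite -powRrM mulVf ?gt_eqF // powRr1 //; lra.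
have r0 : 0 < r by rewrite powR_gt0 //; lra.
have r1 : r < 1.
  rewrite ltNge; apply/negP => r1.
  suff : 1 <= r `^ p by rewrite rp; lra.
  by rewrite -(powRr0 r) ler_powR // ltW.
(* [K] is the least u for which (2 exp(-3u/4))^2 <= exp(-u). *)
pose K := 4 * ln (2 : R).
have K0 : 0 < K by rewrite mulr_gt0 // ln_gt0 // ltr1n.
have d0 : 0 < 1 - r by rewrite subr_gt0.
have : \forall t0 \near +oo, [/\ 0 < t0, f (r * t0) <= expR (- K),
    forall t, t0 <= t -> g ((1 - r) * t) <= expR (- (((1 - r) * t) `^ p)) &
    K <= ((1 - r) * t0) `^ p].
  have [M [_ gM]] := gtail.
  have : \forall t \near +oo, f t <= expR (- K).
    by near=> t; apply: ltW; near: t; apply: (cvgr_lt _ fcv); exact: expR_gt0.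
  move=> [N [_ fN]]; have [B [_ hB]] := near_pinfty_powR_ge K p0.
  near=> t0; split.
  - by near: t0; apply: nbhs_pinfty_gt; exact: num_real.
  - by apply: fN; rewrite mulrC -ltr_pdivrMr //; near: t0; apply: nbhs_pinfty_gt; exact: num_real.
  - move=> t t0t; apply: gM; rewrite mulrC -ltr_pdivrMr //; apply: lt_le_trans t0t.
    by near: t0; apply: nbhs_pinfty_gt; exact: num_real.
  - by apply: hB; rewrite mulrC -ltr_pdivrMr //; near: t0; apply: nbhs_pinfty_gt; exact: num_real.
move=> /(@filter_ex _ _ _) [t0 [t0p ft0 gt0 Kt0]].
have T0 : 0 < t0 `^ p by rewrite powR_gt0.
(* With c t0^p = K, the exponent c t^p is at most K on [r t0, t0], where the bound follows from f (r
   t0) <= exp(-K), and at least K beyond t0, where the recursion needs it. The last condition on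
   [t0] gives c <= (1 - r)^p, so the tail of g at (1 - r) t is also at most exp(-c t^p). *)
pose c := K / t0 `^ p.
have c0 : 0 < c by rewrite divr_gt0.
have cK : c * t0 `^ p = K by rewrite divfK // gt_eqF.
have cd : c <= (1 - r) `^ p.
  by rewrite ler_pdivrMr // -powRM ?(ltW d0) ?(ltW t0p).
exists c => //.
have base t : r * t0 <= t -> t <= t0 -> f t <= expR (- (c * t `^ p)).
  move=> h1 h2; apply: le_trans (fdec _ _ h1) _; apply: le_trans ft0 _.
  rewrite ler_expR lerN2 -cK ler_pM2l //; apply: ge0_ler_powR => //.
  - exact: ltW.
  - by rewrite nnegrE (le_trans _ h1) // mulr_ge0 // ltW.
  - by rewrite nnegrE ltW.
(* Here n bounds the number of contractions by r needed to bring t down to [t0]. From t > t0 a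
   contraction stays above r t0, so it cannot jump over the starting interval. *)
have ind n : forall t, r * t0 <= t -> t * r ^+ n <= t0 -> f t <= expR (- (c * t `^ p)).
  elim: n => [t h1|n IH t h1 h2]; first by rewrite expr0 mulr1; exact: base.
  have [|/ltW tt0] := leP t t0; first exact: base.
  have t_ge0 : 0 <= t by apply: le_trans tt0; exact: ltW.
  have IHt : f (r * t) <= expR (- (c * (r * t) `^ p)).
    by apply: IH; [rewrite ler_pM2l | rewrite (mulrC r) -mulrA -exprS].
  have Kt : K <= c * t `^ p.
    rewrite -cK ler_pM2l //; apply: ge0_ler_powR => //; rewrite ?nnegrE //; exact: ltW.
  have e1 : g ((1 - r) * t) <= expR (- (3 / 4 * (c * t `^ p))).
    apply: le_trans (gt0 _ tt0) _; rewrite ler_expR lerN2 powRM ?(ltW d0) //.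
    have := ler_wpM2r (powR_ge0 t p) cd.
    have : 0 <= c * t `^ p by rewrite mulr_ge0 ?powR_ge0 // ltW.
    lra.
  have e2 : f (r * t) <= expR (- (3 / 4 * (c * t `^ p))).
    by rewrite (le_trans IHt) // powRM ?(ltW r0) // rp mulrCA.
  have -> : t = (1 - r) * t + r * t by ring.
  apply: le_trans (frec _ _) _.
  have -> : (1 - r) * t + r * t = t by ring.
  apply: (@le_trans _ _ ((expR (ln 2 - 3 / 4 * (c * t `^ p))) ^+ 2)).
    rewrite ler_pXn2r ?nnegrE ?expR_ge0 ?addr_ge0 //.
    rewrite expRD lnK ?posrE //; lra.
  by rewrite -expRM_natl ler_expR; rewrite /K in Kt; lra.
near=> t.
have rt : r * t0 <= t by near: t; apply: nbhs_pinfty_ge; exact: num_real.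
have t_gt0 : 0 < t by near: t; apply: nbhs_pinfty_gt; exact: num_real.
have : \forall n \near \oo, `|r ^+ n| < t0 / t.
  apply: cvgr0_norm_lt; last by rewrite divr_gt0.
  by apply: cvg_expr; rewrite ger0_norm // ltW.
move=> /(@filter_ex _ _ _) [n]; rewrite ger0_norm ?exprn_ge0 ?(ltW r0) //.
rewrite ltr_pdivlMr // mulrC => /ltW; exact: ind.
Unshelve. all: by end_near. Qed.

(** * Two inequalities between the distribution functions, from independence *)

Lemma independent_pair {R : realType} {d : measure_display}
    {T : measurableType d} {P : probability T R} {I : finType}
    {X : I -> {RV P >-> R}} {i j : I} {A B : set R} :
  mutually_independent X -> i != j -> measurable A -> measurable B ->
  P (X i @^-1` A `&` X j @^-1` B) = (P (X i @^-1` A) * P (X j @^-1` B))%E.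
Proof.
move=> ind ij mA mB.
have := ind [set i; j]%SET (fun k => if k == i then A else B).
rewrite big_setU1 ?inE //= big_set1 eqxx eq_sym (negbTE ij) => <-; last first.
  by move=> k; case: ifP.
congr (P _); apply/seteqP; split=> t /=.
  move=> [Ai Bj] k /=; rewrite !inE => /orP[]/eqP ->; rewrite ?eqxx //.
  by rewrite eq_sym (negbTE ij).
move=> h; split.
  by have := h i; rewrite /= !inE !eqxx; apply.
by have := h j; rewrite /= !inE eqxx orbT eq_sym (negbTE ij); apply.
Qed.

Lemma positive_RV_cdf0 {R : realType} {d : measure_display}
    {T : measurableType d} {P : probability T R} {X : {RV P >-> R}} :
  positive_RV X -> cdf X 0 = 0%E.
Proof.
move=> Xpos; have -> : cdf X 0 = P (~` (X @^-1` `]0, +oo[)).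
  rewrite /cdf /distribution /pushforward /=; congr (P _).
  by apply/seteqP; split=> t /=; rewrite !in_itv /= andbT leNgt => /negP.
rewrite probability_setC; last exact: measurable_funPTI.
rewrite (_ : X @^-1` _ = [set t | 0 < X t]) ?Xpos ?subee //.
by apply/seteqP; split=> t /=; rewrite in_itv /= andbT.
Qed.

Lemma smoothing_measurable {R : realType} {d : measure_display}
    {T : measurableType d} {P : probability T R} (W0 W1 Y0 Y1 : {RV P >-> R})
    (A : set R) :
  measurable A -> measurable ((fun t => W0 t * Y0 t + W1 t * Y1 t) @^-1` A).
Proof.
move=> mA; rewrite -[X in measurable X]setTI.
apply: measurable_realfun.measurable_funD => //;
  exact: measurable_realfun.measurable_funM.
Qed.

Lemma smoothing_cdf_le {R : realType}
    {dW : measure_display} {TW : measurableType dW} {PW : probability TW R}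
    {W : {RV PW >-> R}}
    {dY : measure_display} {TY : measurableType dY} {PY : probability TY R}
    {Y : {RV PY >-> R}} {a b : R} :
  positive_RV W -> positive_RV Y -> smoothing_fixed_point W Y ->
  0 < a -> 0 < b ->
  fine (cdf Y (a * b)) <= (fine (cdf W a) + fine (cdf Y b)) ^+ 2.
Proof.
move=> Wpos Ypos [d [T [P [W0 [W1 [Y0 [Y1 [ind [eW0 eW1] [eY0 eY1] eY]]]]]]]] a0 b0.
have mI (x : R) : measurable `]-oo, x] by [].
have W0E x : P (W0 @^-1` `]-oo, x]) = cdf W x := eW0 _ (mI x).
have W1E x : P (W1 @^-1` `]-oo, x]) = cdf W x := eW1 _ (mI x).
have Y0E x : P (Y0 @^-1` `]-oo, x]) = cdf Y x := eY0 _ (mI x).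
have Y1E x : P (Y1 @^-1` `]-oo, x]) = cdf Y x := eY1 _ (mI x).
have mle (X : {RV P >-> R}) x : measurable (X @^-1` `]-oo, x]).
  exact: measurable_funPTI.
have PU2 A B : measurable A -> measurable B -> (P (A `|` B) <= P A + P B)%E.
  exact: measureU2.
(* Positivity holds only almost surely; it passes to the copies through the value of the
   distribution function at 0, which makes [N] a null event. *)
pose N := W0 @^-1` `]-oo, 0] `|` W1 @^-1` `]-oo, 0] `|`
          (Y0 @^-1` `]-oo, 0] `|` Y1 @^-1` `]-oo, 0]).
have mN : measurable N by do 2?apply: measurableU; exact: mle.
have PN : P N = 0%E.
  apply/eqP; rewrite -measure_le0.
  apply: le_trans (PU2 _ _ _ _) _; [exact: measurableU|exact: measurableU|].
  rewrite -[leRHS]adde0; apply: leeD;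
    (apply: le_trans (PU2 _ _ _ _) _; [exact: mle|exact: mle|]);
    by rewrite ?W0E ?W1E ?Y0E ?Y1E !positive_RV_cdf0 // adde0.
(* One condition is chosen for each index, so each of the four events pairs a variable of index 0
   with one of index 1. By independence their probabilities are the four terms of the expanded
   square. *)
pose A := W0 @^-1` `]-oo, a] `&` W1 @^-1` `]-oo, a].
pose B := W0 @^-1` `]-oo, a] `&` Y1 @^-1` `]-oo, b].
pose C := Y0 @^-1` `]-oo, b] `&` W1 @^-1` `]-oo, a].
pose D := Y0 @^-1` `]-oo, b] `&` Y1 @^-1` `]-oo, b].
have [mA mB mC mD] : [/\ measurable A, measurable B, measurable C & measurable D].
  by split; apply: measurableI; exact: mle.
have sub : (fun t => W0 t * Y0 t + W1 t * Y1 t) @^-1` `]-oo, a * b] `<=`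
    (A `|` B) `|` (C `|` D) `|` N.
  move=> t; rewrite /A /B /C /D /N /= !in_itv /= => St.
  have [|w0] := leP (W0 t) 0; first by move=> ?; right; left; left.
  have [|w1] := leP (W1 t) 0; first by move=> ?; right; left; right.
  have [|y0] := leP (Y0 t) 0; first by move=> ?; right; right; left.
  have [|y1] := leP (Y1 t) 0; first by move=> ?; right; right; right.
  left.
  have h0 : W0 t <= a \/ Y0 t <= b.
    have [?|aw] := leP (W0 t) a; [by left|right].
    rewrite leNgt; apply/negP => yb; have := ltr_pM (ltW a0) (ltW b0) aw yb.
    have := mulr_gt0 w1 y1; lra.
  have h1 : W1 t <= a \/ Y1 t <= b.
    have [?|aw] := leP (W1 t) a; [by left|right].
    rewrite leNgt; apply/negP => yb; have := ltr_pM (ltW a0) (ltW b0) aw yb.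
    have := mulr_gt0 w0 y0; lra.
  by case: h0; case: h1; tauto.
have PE : (cdf Y (a * b) <= P A + P B + (P C + P D))%E.
  have -> : cdf Y (a * b) = P ((fun t => W0 t * Y0 t + W1 t * Y1 t) @^-1` `]-oo, a * b]).
    exact: (eY _ (mI _)).
  have mAB : measurable (A `|` B) by exact: measurableU.
  have mCD : measurable (C `|` D) by exact: measurableU.
  apply: (le_trans (le_measure _ _ _ sub)); rewrite ?inE.
  - exact: smoothing_measurable.
  - by apply: measurableU => //; exact: measurableU.
  apply: le_trans (PU2 _ _ (measurableU _ _ mAB mCD) mN) _.
  rewrite PN adde0; apply: le_trans (PU2 _ _ mAB mCD) _.
  by apply: leeD; exact: PU2.
(* Positions 0, 1, 2, 3 of the tuple are [W0], [W1], [Y0], [Y1]. *)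
have pair i j x y (ij : i != j) := independent_pair ind ij (mI x) (mI y).
have := pair 0 1 a a isT; have := pair 0 3%:R a b isT.
have := pair 2%:R 1 b a isT; have := pair 2%:R 3%:R b b isT.
rewrite !(tnth_nth W0) /= -/A -/B -/C -/D W0E W1E Y0E Y1E => DE CE BE AE.
move: PE; rewrite {}AE {}BE {}CE {}DE.
have fin dX (TX : measurableType dX) (PX : probability TX R) (X : {RV PX >-> R}) x :
    cdf X x = (fine (cdf X x))%:E by rewrite fineK // fin_num_measure.
rewrite (fin _ _ _ W) (fin _ _ _ Y b) (fin _ _ _ Y (a * b)) lee_fin => h.
by apply: le_trans h _; lra.
Qed.

(** For W_i > 0 and b >= 0, W_i Y_i <= W_i b <= a b, so the null event to discard concerns the signs
    of the W_i. Independence is applied to all four variables at once. *)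
Lemma smoothing_cdf_ge {R : realType}
    {dW : measure_display} {TW : measurableType dW} {PW : probability TW R}
    {W : {RV PW >-> R}}
    {dY : measure_display} {TY : measurableType dY} {PY : probability TY R}
    {Y : {RV PY >-> R}} {a b : R} :
  positive_RV W -> smoothing_fixed_point W Y -> 0 <= b ->
  (fine (cdf W a) * fine (cdf Y b)) ^+ 2 <= fine (cdf Y (2 * a * b)).
Proof.
move=> Wpos [d [T [P [W0 [W1 [Y0 [Y1 [ind [eW0 eW1] [eY0 eY1] eY]]]]]]]] b0.
have mI (x : R) : measurable `]-oo, x] by [].
have W0E x : P (W0 @^-1` `]-oo, x]) = cdf W x := eW0 _ (mI x).
have W1E x : P (W1 @^-1` `]-oo, x]) = cdf W x := eW1 _ (mI x).
have Y0E x : P (Y0 @^-1` `]-oo, x]) = cdf Y x := eY0 _ (mI x).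
have Y1E x : P (Y1 @^-1` `]-oo, x]) = cdf Y x := eY1 _ (mI x).
have mle (X : {RV P >-> R}) x : measurable (X @^-1` `]-oo, x]).
  exact: measurable_funPTI.
have PU2 A B : measurable A -> measurable B -> (P (A `|` B) <= P A + P B)%E.
  exact: measureU2.
pose N := W0 @^-1` `]-oo, 0] `|` W1 @^-1` `]-oo, 0].
have mN : measurable N by apply: measurableU; exact: mle.
have PN : P N = 0%E.
  apply/eqP; rewrite -measure_le0.
  apply: le_trans (PU2 _ _ _ _) _; [exact: mle|exact: mle|].
  by rewrite W0E W1E !positive_RV_cdf0 // adde0.
pose S := (fun t => W0 t * Y0 t + W1 t * Y1 t) @^-1` `]-oo, 2 * a * b].
have mS : measurable S by exact: smoothing_measurable.
pose I4 := [tuple `]-oo, a]%classic; `]-oo, a]%classic; `]-oo, b]%classic;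
  `]-oo, b]%classic].
have mI4 i : measurable (tnth I4 i).
  by rewrite (tnth_nth setT); case: i => [[|[|[|[|//]]]] ?] /=.
have := ind [set: 'I_4]%SET (tnth I4) mI4.
set A := \bigcap_(_ in _) _ => AE.
have mA : measurable A.
  apply: fin_bigcap_measurable; first exact: (finite_finpred [set: 'I_4]%SET).
  by move=> i _; apply: measurable_funPTI => //; exact: mI4.
have {}AE : P A = (cdf W a * (cdf W a * (cdf Y b * cdf Y b)))%E.
  rewrite AE.
  rewrite (eq_bigl xpredT); last by move=> i; rewrite inE.
  rewrite !big_ord_recl big_ord0 mule1 !(tnth_nth W0) !(tnth_nth setT) /=.
  by rewrite W0E W1E Y0E Y1E.
have sub : A `<=` S `|` N.
  move=> t At.
  have {}At i : (tnth [tuple W0; W1; Y0; Y1] i) t <= nth 0 [:: a; a; b; b] i.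
    have := At i; rewrite /= inE => /(_ isT).
    by case: i => [[|[|[|[|//]]]] ?]; rewrite !(tnth_nth W0) !(tnth_nth setT) /= in_itv.
  have := At 0; have := At 1; have := At 2%:R; have := At 3%:R.
  rewrite !(tnth_nth W0) /= => y1b y0b w1a w0a.
  rewrite /S /N /= !in_itv /=.
  have [|w0] := leP (W0 t) 0; first by right; left.
  have [|w1] := leP (W1 t) 0; first by right; right.
  left.
  have := ler_wpM2l (ltW w0) y0b; have := ler_wpM2l (ltW w1) y1b.
  have := ler_wpM2r b0 w0a; have := ler_wpM2r b0 w1a; lra.
have : (P A <= cdf Y (2 * a * b))%E.
  have -> : cdf Y (2 * a * b) = P S by exact: (eY _ (mI _)).
  apply: (le_trans (le_measure _ _ _ sub)); rewrite ?inE //; first exact: measurableU.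
  by apply: le_trans (PU2 _ _ mS mN) _; rewrite PN adde0.
have fin dX (TX : measurableType dX) (PX : probability TX R) (X : {RV PX >-> R}) x :
    cdf X x = (fine (cdf X x))%:E by rewrite fineK // fin_num_measure.
rewrite AE (fin _ _ _ W) (fin _ _ _ Y b) (fin _ _ _ Y (2 * a * b)) -!EFinM lee_fin.
apply: le_trans; lra.
Qed.

(** * Distribution functions in the variable t, and the theorem *)

Lemma loglog_ratio_expRN_cvg {R : realType} {d : measure_display}
    {T : measurableType d} {P : probability T R} {X : {RV P >-> R}} {g : R} :
  (loglog_ratio X x @[x --> 0^'+] --> g) <->
  (ln (ln (1 / fine (cdf X (expR (- t))))) / ln t @[t --> +oo] --> g).
Proof.
have E t : loglog_ratio X (expR (- t)) =
    ln (ln (1 / fine (cdf X (expR (- t))))) / ln t.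
  by rewrite /loglog_ratio [1 / expR _]div1r -expRN opprK expRK.
split=> /cvgrPdist_le h; apply/cvgrPdist_le => e e0.
  have := (near_expRN _).1 (h e e0).
  by apply: filterS => t; rewrite E.
by apply/near_expRN; have := h e e0; apply: filterS => t; rewrite E.
Qed.

(** Right continuity of the distribution function at 0, where it vanishes. This starts the recursion
    for Y. *)
Lemma positive_RV_cdf_expRN_cvg0 {R : realType} {d : measure_display}
    {T : measurableType d} {P : probability T R} {X : {RV P >-> R}} :
  positive_RV X -> fine (cdf X (expR (- t))) @[t --> +oo] --> (0 : R).
Proof.
move=> Xpos.
have cv : fine (cdf X x) @[x --> 0^'+] --> (0 : R).
  apply: fine_cvg; have := @cdf_right_continuous _ _ _ P X 0.
  by rewrite (positive_RV_cdf0 Xpos).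
apply/cvgrPdist_le => e e0; apply/(near_expRN (fun x => `|0 - fine (cdf X x)| <= e)).
by move/cvgrPdist_le : cv; apply.
Qed.

Theorem corollary3 (R : realType)
    (dW : measure_display) (TW : measurableType dW) (PW : probability TW R)
    (W : {RV PW >-> R})
    (dY : measure_display) (TY : measurableType dY) (PY : probability TY R)
    (Y : {RV PY >-> R})
    (gamma : R)
    (hWpos : positive_RV W)
    (hgamma : 1 < gamma)
    (hW : loglog_ratio W x @[x --> 0^'+] --> gamma)
    (hYpos : positive_RV Y)
    (hY : smoothing_fixed_point W Y) :
  loglog_ratio Y x @[x --> 0^'+] --> gamma.
Proof.
have g0 : 0 < gamma by rewrite (lt_trans ltr01).
have cW0 t : 0 <= fine (cdf W (expR (- t))) by rewrite fine_ge0 // cdf_ge0.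
have cY0 t : 0 <= fine (cdf Y (expR (- t))) by rewrite fine_ge0 // cdf_ge0.
have [Wlo Wup] := (loglog_tailP g0 cW0).1 (loglog_ratio_expRN_cvg.1 hW).
apply/loglog_ratio_expRN_cvg; apply/(loglog_tailP g0 cY0).
split=> [p /andP[p0 pg]|q gq].
  (* The recursion yields exp(-c t^p') with an uncontrolled c; since p < p', eventually c t^(p' - p)
     >= 1, which leaves exp(-t^p). *)
  pose p' := (p + gamma) / 2.
  have [|||||||c c0 ctail] := @near_powR_tail_le_of_rec R (fun t => fine (cdf Y (expR (- t))))
      (fun t => fine (cdf W (expR (- t)))) p'.
  - by rewrite /p'; lra.
  - exact: cY0.
  - exact: cW0.
  - move=> s t ts; apply: fine_le; rewrite ?fin_num_measure //.
    by apply: cdf_nondecreasing; rewrite ler_expR lerN2.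
  - exact: positive_RV_cdf_expRN_cvg0.
  - move=> s t; rewrite opprD expRD.
    by apply: smoothing_cdf_le; rewrite ?expR_gt0.
  - by apply: Wlo; rewrite /p'; lra.
  near=> t; apply: (@le_trans _ _ (expR (- (c * t `^ p')))); first by near: t.
  have t0 : 0 < t by near: t; exact: nbhs_pinfty_gt.
  have ct : c^-1 <= t `^ (p' - p).
    by near: t; apply: near_pinfty_powR_ge; rewrite /p'; lra.
  rewrite ler_expR lerN2 -(subrK p p') powRD; last by apply/implyP => _; rewrite gt_eqF.
  rewrite mulrA ler_peMl ?powR_ge0 //.
  by rewrite -ler_pdivrMl // mulr1.
have [M [M0 YM]] : exists M, 0 < M /\ 0 < fine (cdf Y M).
  have : \forall M \near +oo, 0 < M /\ 0 < fine (cdf Y M).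
    have cv : fine (cdf Y M) @[M --> +oo] --> (1 : R).
      exact: (fine_cvg (cvg_cdfy1 Y)).
    near=> M; split; first by near: M; exact: nbhs_pinfty_gt.
    by near: M; apply: (cvgr_gt _ cv).
  by move=> /(@filter_ex _ _ _).
pose q' := (gamma + q) / 2.
(* Chosen so that exp(-t) = 2 exp(-(t + C)) M, the form 2 a b of the lower inequality with b = M
   fixed. *)
pose C := ln (2 * M).
have M20 : 0 < 2 * M by rewrite mulr_gt0.
near=> t; apply: le_trans (_ : (expR (- ((t + C) `^ q')) * fine (cdf Y M)) ^+ 2 <= _).
  by near: t; apply: near_sqr_powR_tail_ge => //; rewrite /q'; lra.
have -> : expR (- t) = 2 * expR (- (t + C)) * M.
  by rewrite opprD expRD (expRN C) lnK ?posrE //; field; rewrite gt_eqF.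
apply: le_trans (smoothing_cdf_ge hWpos hY (ltW M0)).
rewrite ler_pXn2r ?nnegrE ?mulr_ge0 ?expR_ge0 ?fine_ge0 ?cdf_ge0 //.
rewrite ler_pM2r //; near: t.
have [N [_ hN]] : \forall t \near +oo, expR (- (t `^ q')) <= fine (cdf W (expR (- t))).
  by apply: Wup; rewrite /q'; lra.
exists (N - C); split; first exact: num_real.
by move=> t Nt; apply: hN; rewrite -ltrBlDr.
Unshelve. all: by end_near. Qed.
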